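(* Let $\mathbf{f},\mathbf{r},\mathbf{d},\mathbf{b},\mathbf{t}$ be the ideals in $\mathbb{N}$ of, respectively, finite sets, sets with convergent reciprocal series, sets of density zero, sets of Banach density zero, and sets of tile density zero. Then the following much larger inclusions hold: \[ \mathbf{f}\Subset\mathbf{t}\cap\mathbf{r}\Subset\mathbf{b}\cap\mathbf{r}\Subset\mathbf{r},\qquad \mathbf{t}\Subset\mathbf{b}\Subset\mathbf{d}\Subset 2^{\mathbb{N}}, \] \[ \mathbf{t}\cap\mathbf{r}\Subset\mathbf{t},\qquad \mathbf{b}\cap\mathbf{r}\Subset\mathbf{b},\qquad \mathbf{r}\Subset\mathbf{d}. \]
   Context: $\mathbb{N}=\{1,2,3,\ldots\}$, $\mathbb{N}_0=\mathbb{N}\cup\{0\}$; for integers $a\le b$, $[a,b]=\{a,a+1,\ldots,b\}$; for $K\subseteq\mathbb{N}_0$ and $a\in\mathbb{N}_0$, $K+a=\{k+a: k\in K\}$; $|B|$ is the cardinality of $B$. A set $\mathbf{i}\subseteq 2^{\mathbb{N}}$ is an ideal in $\mathbb{N}$ if (1) $A,B\in\mathbf{i}$ implies $A\cup B\in\mathbf{i}$, and (2) $A\in\mathbf{i}$ and $B\subseteq A$ imply $B\in\mathbf{i}$. For ideals $\mathbf{i},\mathbf{j}$ in $\mathbb{N}$, we write $\mathbf{i}\Subset\mathbf{j}$ ($\mathbf{j}$ is much larger than $\mathbf{i}$) if $\mathbf{i}\subsetneq\mathbf{j}$ and there exists a countable collection $\{D_j\}_{j\in\mathbb{N}}\subseteq\mathbf{i}$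 of non-empty pairwise disjoint sets such that $\bigcup_{k\in K}D_k\in\mathbf{j}\setminus\mathbf{i}$ for every infinite subset $K\subseteq\mathbb{N}$. The ideals are defined as follows. - $\mathbf{f}$ is the ideal of all finite subsets of $\mathbb{N}$. For $C,D\subseteq\mathbb{N}$, $C\subseteq D \bmod \mathbf{f}$ means $C\subseteq D\cup F$ for some $F\in\mathbf{f}$. - $\mathbf{r}=\{X\subseteq\mathbb{N}:\sum_{x\in X}x^{-1}<\infty\}$. - The density of $X\subseteq\mathbb{N}$ is $d(X)=\lim_{n\to\infty}|X\cap[1,n]|/n$ (if this limit exists), and $\mathbf{d}=\{X\subseteq\mathbb{N}: d(X)=0\}$. - The Banach density of $X\subseteq\mathbb{N}$ is $b(X)=\lim_{n\to\infty}\max_{k\in\mathbb{N}_0}|X\cap[k+1,k+n]|/n$, and $\mathbf{b}=\{X\subseteq\mathbb{N}: b(X)=0\}$. - For $r\in\mathbb{N}$ let $\mathcal{T}_r=2^{[0,r-1]}$, and let $\mathcal{T}=\left\{\left(\bigcup_{j=0}^\infty (T+jr)\right)+b : r,b\in\mathbb{N},\ T\in\mathcal{T}_r\right\}\subseteq 2^{\mathbb{N}}$. The tile density of $X\subseteq\mathbb{N}$ is $\mathrm{tile}(X)=\inf\{d(A): A\in\mathcal{T},\ X\subseteq A \bmod \mathbf{f}\}$, and $\mathbf{t}=\{X\subseteq\mathbb{N}:\mathrm{tile}(X)=0\}$. *)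

(* Defs.v *)
From HB Require Import structures.
From mathcomp Require Import all_boot all_order all_algebra finmap.
From mathcomp Require Import all_classical all_reals all_analysis.

Set Implicit Arguments.
Unset Strict Implicit.
Unset Printing Implicit Defensive.

Import Order.TTheory GRing.Theory Num.Theory.
Import numFieldNormedType.Exports.

Local Open Scope classical_set_scope.
Local Open Scope ring_scope.

(* Positive integers {1, 2, 3, ...}; subsets of it are modelled as sets of
   type [set nat] included in [posnat], and families of them as
   [set (set nat)]. *)
Definition posnat : set nat := [set n | (0 < n)%N].

Definition all_subsets : set (set nat) := [set X | X `<=` posnat].

Definition is_ideal (I : set (set nat)) : Prop :=
  [/\ I `<=` all_subsets,
      forall A B, I A -> I B -> I (A `|` B) &
      forall A B, I A -> B `<=` A -> I B].

(* The relation is only meaningful between ideals, so being an ideal is part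
   of it. Only the values of [D] at indices in [posnat] matter. *)
Definition much_larger (I J : set (set nat)) : Prop :=
  [/\ is_ideal I, is_ideal J, I `<` J &
      exists D : nat -> set nat,
        [/\ forall j, posnat j -> I (D j),
            forall j, posnat j -> D j !=set0,
            trivIset posnat D &
            forall K : set nat, K `<=` posnat -> infinite_set K ->
              (J `\` I) (\bigcup_(k in K) D k)]].

Definition integer_interval (a b : nat) : set nat :=
  [set k | (a <= k <= b)%N].

Definition translate (K : set nat) (a : nat) : set nat :=
  [set (k + a)%N | k in K].

(* Only applied to finite sets; [fset_set] is empty on infinite ones. *)
Definition finite_card (A : set nat) : nat := #|` fset_set A|%fset.

Definition finite_ideal : set (set nat) :=
  [set X | X `<=` posnat /\ finite_set X].

Definition subset_mod_finite (C D : set nat) : Prop :=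
  exists2 F, finite_ideal F & C `<=` D `|` F.

Definition reciprocal_ideal (R : realType) : set (set nat) :=
  [set X | X `<=` posnat /\
           (\esum_(x in X) ((x%:R : R)^-1)%:E < +oo)%E].

(* [has_density X l] : the density of [X] exists and is equal to [l]. *)
Definition has_density (R : realType) (X : set nat) (l : R) : Prop :=
  (fun n : nat => (finite_card (X `&` integer_interval 1 n))%:R / n%:R : R)
    @ \oo --> l.

Definition density_ideal (R : realType) : set (set nat) :=
  [set X | X `<=` posnat /\ has_density X (0 : R)].

(* The supremum below is a maximum: for fixed [n] the cardinals are bounded by
   [n], hence take finitely many values. *)
Definition max_window_density (R : realType) (X : set nat) (n : nat) : R :=
  sup [set (finite_card (X `&` integer_interval k.+1 (k + n)%N))%:R / n%:R
      | k in [set: nat]].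

Definition has_banach_density (R : realType) (X : set nat) (l : R) : Prop :=
  max_window_density R X @ \oo --> l.

Definition banach_ideal (R : realType) : set (set nat) :=
  [set X | X `<=` posnat /\ has_banach_density X (0 : R)].

Definition is_tiling (A : set nat) : Prop :=
  exists (r b : nat) (T : set nat),
    [/\ posnat r, posnat b, T `<=` integer_interval 0 r.-1 &
        A = translate (\bigcup_j translate T (j * r)%N) b].

(* Every tiling has a density, so no tiling is left out of the infimum. *)
Definition tile_density (R : realType) (X : set nat) : R :=
  inf [set l : R | exists A : set nat,
         [/\ is_tiling A, subset_mod_finite X A & has_density A l]].

Definition tile_ideal (R : realType) : set (set nat) :=
  [set X | X `<=` posnat /\ tile_density R X = 0].

(* Main.v *)
Require Import Defs.
From mathcomp Require Import all_boot all_order all_algebra finmap.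
From mathcomp Require Import all_classical all_reals all_analysis.
From mathcomp Require Import zify ring lra.

Set Implicit Arguments.
Unset Strict Implicit.
Unset Printing Implicit Defensive.

Import Order.TTheory GRing.Theory Num.Theory.
Import numFieldNormedType.Exports.

Local Open Scope classical_set_scope.

(** All nine relations follow from one pattern. Cut the positive integers into
    consecutive finite blocks [[c j, c j.+1)], take a set [X] in the larger ideal
    [J], and let [D j] be the piece of [X] in the [j]-th block. The pieces are
    finite and disjoint, and every union of them is in [J] because [X] is. What
    remains is to make the pieces large for the smaller ideal [I]: no member of
    [I] may contain infinitely many of them ([blocks_escape] and
    [much_larger_of_blocks]). Four sets [X], and one intersection, are enough.

    - [sparse_runs] consists of the runs [[4 ^ j, 4 ^ j + 2 ^ j)]. The reciprocals
      of a run sum to at most [2 ^- j], so the set has a convergent reciprocal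
      series; but a set with infinitely many of these runs has full windows of
      unbounded length, hence is not of Banach density zero.
    - [factorial_shifts] consists of the numbers [m`! + m]. They grow fast and
      their gaps tend to infinity, so the set is in both the reciprocal and the
      Banach ideal. As [m`! + m] is congruent to [m] modulo every [r <= m], a piece
      with [m] from [2 ^ j] to [2 ^ j.+1] meets all residue classes of every period
      up to [2 ^ j]; but a set of tile density zero eventually avoids some residue
      class of some period.
    - [slowly_divisible] is eventually divisible by each power of two, which gives
      it tile density zero; divisibility by the next power is demanded so late that
      each piece has a reciprocal sum of at least [1].
    - [posnat] itself, with dyadic blocks: a set containing the block
      [[2 ^ j, 2 ^ j.+1)] has at least half of the integers below its end.
    - [sparse_runs `&` slowly_divisible] is infinite (it contains every [4 ^ j]) and
      lies in both the tile and the reciprocal ideal.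

    Each ideal is first described by finite counts: [density_idealP] and
    [banach_idealP] by the number of elements in windows, [reciprocal_idealP] by
    bounded partial sums, and [tile_idealP] by eventually containing periodic sets
    with few elements per period. In this form the ideal axioms and the inclusions
    of the tile ideal in the Banach ideal, of that in the density ideal, and of the
    reciprocal ideal in the density ideal are estimates for finite sums. *)

(** * Counting in windows *)

Definition window_count (X : set nat) (k n : nat) : nat :=
  \sum_(k <= i < k + n) (i \in X).

Lemma eq_in_set (A B : set nat) x y : (A x <-> B y) -> (x \in A) = (y \in B).
Proof. by move=> AB; apply/idP/idP => /set_mem/AB/mem_set. Qed.

Lemma finite_integer_interval a b : finite_set (integer_interval a b).
Proof.
apply: (@sub_finite_set _ _ `I_(b.+1)); last exact: finite_II.
by move=> k /= /andP[].
Qed.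

Lemma finite_card_window X k n :
  finite_card (X `&` integer_interval k.+1 (k + n)) = window_count X k.+1 n.
Proof.
have finI : finite_set (X `&` integer_interval k.+1 (k + n)).
  exact: finite_setIr (finite_integer_interval _ _).
rewrite /finite_card /window_count.
have -> : \sum_(k.+1 <= i < k.+1 + n) (i \in X) =
    size [seq i <- index_iota k.+1 (k.+1 + n) | i \in X].
  by rewrite size_filter -sum1_count [RHS]big_mkcond; apply: eq_bigr => i _;
    case: (i \in X).
apply/perm_size/uniq_perm; first exact: fset_uniq.
  by rewrite filter_uniq // iota_uniq.
move=> i; rewrite mem_filter mem_index_iota.
rewrite [LHS](in_fset_set finI) in_setI; congr (_ && _).
by rewrite mem_setE addSn ltnS.
Qed.

Lemma window_countD X k m n :
  window_count X k (m + n) = window_count X k m + window_count X (k + m) n.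
Proof.
by rewrite /window_count (@big_cat_nat _ _ _ (k + m)) ?leq_addr ?addnA ?leq_addr.
Qed.

Lemma window_count_le_size X k n : window_count X k n <= n.
Proof.
apply: (@leq_trans (\sum_(k <= i < k + n) 1)).
  by apply: leq_sum => i _; case: (i \in X).
by rewrite sum_nat_const_nat muln1 addKn.
Qed.

Lemma window_count_widen X k m n :
  m <= n -> window_count X k m <= window_count X k n.
Proof. by move=> /subnKC <-; rewrite window_countD leq_addr. Qed.

Lemma window_count_sub (X Y : set nat) k n :
    (forall i, k <= i < k + n -> X i -> Y i) ->
  window_count X k n <= window_count Y k n.
Proof.
move=> XY; rewrite /window_count big_seq [leqRHS]big_seq.
apply: leq_sum => i; rewrite mem_index_iota => /XY {}XY.
by case: (boolP (i \in X)) => // /set_mem/XY/mem_set ->.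
Qed.

Lemma window_countU X Y k n :
  window_count (X `|` Y) k n <= window_count X k n + window_count Y k n.
Proof.
rewrite /window_count -big_split /=; apply: leq_sum => i _.
by rewrite in_setU; case: (i \in X); case: (i \in Y).
Qed.

Lemma window_count_full (X : set nat) k n :
  (forall i, k <= i < k + n -> X i) -> window_count X k n = n.
Proof.
move=> kX; rewrite /window_count (eq_big_nat _ _ (F2 := fun=> 1)).
  by rewrite sum_nat_const_nat muln1 addKn.
by move=> i /kX/mem_set ->.
Qed.

Lemma window_count_eq0 (X : set nat) k n :
  (forall i, k <= i < k + n -> ~ X i) -> window_count X k n = 0.
Proof.
move=> kX; rewrite /window_count big1_seq // => i.
rewrite mem_index_iota => /kX nXi.
by apply/eqP; rewrite eqb0; apply/negP => /set_mem.
Qed.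

(** Sets with large gaps have at most one element in a short window; the form of
    the hypothesis is that no gap between two elements fits inside it. *)
Lemma window_count_le1 (X : set nat) k n :
    (forall x y, X x -> X y -> k <= x -> x < y -> k + n <= y) ->
  window_count X k n <= 1.
Proof.
elim: n => [|n IHn] gap; first by rewrite /window_count addn0 big_geq.
rewrite /window_count addnS big_nat_recr ?leq_addr //= -/(window_count _ _ _).
case: (boolP (k + n \in X)) => [/set_mem Xkn|_]; last first.
  rewrite addn0; apply: IHn => x y Xx Xy kx xy.
  by have := gap x y Xx Xy kx xy; lia.
rewrite -/(window_count X k n) window_count_eq0 // => i ik Xi.
by have := gap i _ Xi Xkn; lia.
Qed.

(** * Periodic sets *)

Definition periodic_set (r : nat) (P : set nat) :=
  forall x, (x + r \in P) = (x \in P).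

Lemma periodic_mul r P q x : periodic_set r P -> (x + q * r \in P) = (x \in P).
Proof.
move=> perP; elim: q => [|q IHq]; first by rewrite addn0.
by rewrite mulSnr addnA perP.
Qed.

Lemma periodic_modn r P x : periodic_set r P -> (x %% r \in P) = (x \in P).
Proof.
by move=> perP; rewrite {2}(divn_eq x r) addnC periodic_mul.
Qed.

Lemma periodic_eqmod r P x y :
  periodic_set r P -> x = y %[mod r] -> (x \in P) = (y \in P).
Proof.
by move=> perP xy; rewrite -(periodic_modn x perP) xy periodic_modn.
Qed.

Lemma periodic_dvd r s P : periodic_set r P -> r %| s -> periodic_set s P.
Proof. by move=> perP /dvdnP[q ->] x; rewrite periodic_mul. Qed.

(** Moving the window by one step exchanges [k] for [k + r], which have the same
    residue. *)
Lemma window_count_periodic r P k :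
  periodic_set r P -> window_count P k r = window_count P 0 r.
Proof.
move=> perP; elim: k => // k <-.
have e1 : window_count P k r.+1 = (k \in P) + window_count P k.+1 r.
  by rewrite /window_count addnS -addSn big_ltn // addSn; lia.
have e2 : window_count P k r.+1 = window_count P k r + (k + r \in P).
  by rewrite /window_count addnS big_nat_recr ?leq_addr.
by move: e1; rewrite e2 perP; lia.
Qed.

Lemma window_count_periodic_mul r P k q :
  periodic_set r P -> window_count P k (q * r) = q * window_count P 0 r.
Proof.
move=> perP; elim: q => [|q IHq]; first by rewrite mul0n /window_count addn0 big_geq.
by rewrite !mulSnr window_countD IHq (window_count_periodic _ perP).
Qed.

(** * The density ideals, in terms of counts *)

Section Densities.
Variable R : realType.
Local Open Scope ring_scope.

Lemma eventually_le_mul (C e : R) :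
  0 < e -> exists M : nat, forall n : nat, (M <= n)%N -> C <= e * n%:R.
Proof.
move=> e0; exists (Num.truncn (C / e)).+1 => n Mn.
rewrite mulrC -ler_pdivrMr //; apply: (le_trans (ltW (truncnS_gt _))).
by rewrite ler_nat.
Qed.

(** A bound on the counts up to an additive constant determines the density. *)
Lemma has_density_of_bounded_error (A : set nat) (l C : R) :
    (forall n, `|(window_count A 1 n)%:R - l * n%:R| <= C) ->
  has_density A l.
Proof.
move=> errC; apply/cvgrPdist_le => e e0.
have [M MC] := eventually_le_mul C e0.
near=> n.
have n0 : (0 < n)%N by near: n; exact: nbhs_infty_gt.
have nR : (0 : R) < n%:R by rewrite ltr0n.
rewrite (finite_card_window A 0 n) distrC.
rewrite -(ler_pM2r nR) -{2}(gtr0_norm nR) -normrM mulrBl divfK ?gt_eqF //.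
by apply: (le_trans (errC n)); apply: MC; near: n; exact: nbhs_infty_ge.
Unshelve. all: by end_near. Qed.

Lemma has_density_unique (A : set nat) (l m : R) :
  has_density A l -> has_density A m -> l = m.
Proof. by move=> Al Am; apply: cvg_unique Al Am. Qed.

Lemma has_density_ge0 (A : set nat) (l : R) : has_density A l -> 0 <= l.
Proof.
move=> Al; rewrite -(cvg_lim (@norm_hausdorff _ _) Al).
apply: limr_ge; first by apply: cvgP Al.
by near=> n; rewrite divr_ge0.
Unshelve. all: by end_near. Qed.

Lemma density_idealP (X : set nat) :
  density_ideal R X <-> X `<=` posnat /\
    forall e : R, 0 < e -> exists M : nat, forall n, (M <= n)%N ->
      (window_count X 1 n)%:R <= e * n%:R.
Proof.
have absE (n : nat) : (0 < n)%N ->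
    `|0 - (finite_card (X `&` integer_interval 1 n))%:R / n%:R| =
    (window_count X 1 n)%:R / n%:R :> R.
  move=> n0; rewrite (finite_card_window X 0 n) sub0r normrN.
  by rewrite ger0_norm // divr_ge0.
split=> -[Xpos dX]; split=> //.
  move=> e e0; have [M _ Me] := (cvgrPdist_le _ _).1 dX e e0.
  exists M => n /Me /=; case: n => [|n].
    by rewrite /window_count big_geq ?mulr0.
  by rewrite absE // ler_pdivrMr // ltr0n.
apply/cvgrPdist_le => e e0; have [M Me] := dX e e0.
exists (maxn M 1) => // n /=; rewrite geq_max => /andP[Mn n0].
by rewrite absE // ler_pdivrMr ?ltr0n // Me.
Qed.

Lemma banach_idealP (X : set nat) :
  banach_ideal R X <-> X `<=` posnat /\
    forall e : R, 0 < e -> exists M : nat, forall n k, (M <= n)%N ->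
      (window_count X k.+1 n)%:R <= e * n%:R.
Proof.
pose W n := [set (finite_card (X `&` integer_interval k.+1 (k + n)%N))%:R / n%:R
  | k in [set: nat]] : set R.
have Wne n : W n !=set0.
  exists ((finite_card (X `&` integer_interval 1 (0 + n)%N))%:R / n%:R).
  by exists 0%N.
have Wub n : has_ubound (W n).
  exists 1 => _ [k _ <-]; rewrite finite_card_window.
  case: n => [|n]; first by rewrite invr0 mulr0 ler01.
  by rewrite ler_pdivrMr ?ltr0n // mul1r ler_nat window_count_le_size.
have W0 n : 0 <= max_window_density R X n.
  have [w Ww] := Wne n; apply: le_trans (ub_le_sup (Wub n) Ww).
  by case: Ww => k _ <-; rewrite divr_ge0.
split=> -[Xpos bX]; split=> //.
  move=> e e0; have [M _ Me] := (cvgrPdist_le _ _).1 bX e e0.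
  exists M => n k /Me /=; rewrite sub0r normrN ger0_norm // => We.
  case: n We => [|n] We; first by rewrite /window_count addn0 big_geq ?mulr0.
  rewrite -ler_pdivrMr ?ltr0n //; apply: le_trans We; apply: (ub_le_sup (Wub _)).
  by exists k => //; rewrite finite_card_window.
apply/cvgrPdist_le => e e0; have [M Me] := bX e e0.
exists (maxn M 1) => // n /=; rewrite geq_max => /andP[Mn n0].
rewrite sub0r normrN ger0_norm //; apply: (ge_sup (Wne n)) => _ [k _ <-].
by rewrite finite_card_window ler_pdivrMr ?ltr0n // Me.
Qed.

(** Long windows are cut into windows of one fixed length; those starting
    before [N] cost at most [N] points. *)
Lemma banach_of_windows (X : set nat) : X `<=` posnat ->
    (forall e : R, 0 < e -> exists L N : nat, (0 < L)%N /\
      forall k, (N <= k)%N -> (window_count X k L)%:R <= e * L%:R) ->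
  banach_ideal R X.
Proof.
move=> Xpos Xwin; apply/banach_idealP; split=> // e e0.
have e20 : 0 < e / 2 by rewrite divr_gt0.
have [L [N [L0 XL]]] := Xwin _ e20.
have [M MC] := eventually_le_mul (N%:R + e / 2 * L%:R) e20.
exists M => n k /MC Mn.
have XqL q j : (N <= j)%N -> (window_count X j (q * L))%:R <= e / 2 * (q * L)%:R.
  move=> Nj; elim: q => [|q IHq].
    by rewrite mul0n /window_count addn0 big_geq // mulr0.
  rewrite mulSnr window_countD !natrD mulrDr lerD // XL //; lia.
have kn : (window_count X k.+1 n <=
    N + window_count X (k.+1 + N) ((n %/ L).+1 * L))%N.
  apply: (leq_trans (window_count_widen _ _ (leq_addl N n))).
  rewrite window_countD leq_add ?window_count_le_size //.
  by apply: window_count_widen; rewrite ltnW // ltn_ceil.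
move: kn; rewrite -(ler_nat R) natrD => /le_trans; apply.
have NkN : (N <= k.+1 + N)%N by lia.
have nL : ((n %/ L).+1 * L)%:R <= n%:R + L%:R :> R.
  by rewrite -natrD ler_nat mulSnr leq_add2r leq_divM.
have := XqL (n %/ L).+1 _ NkN; have := ler_wpM2l (ltW e20) nL.
move: Mn; rewrite mulrDr; lra.
Qed.

End Densities.

(** * Tile density, in terms of periodic sets *)

Lemma window_count_initial N k n : window_count `I_N k n <= N.
Proof.
apply: (@leq_trans (window_count `I_N 0 (N + (k + n)))).
  rewrite addnCA window_countD add0n; apply: (leq_trans _ (leq_addl _ _)).
  exact/window_count_widen/leq_addl.
rewrite window_countD add0n -[leqRHS]addn0; apply: leq_add.
  exact: window_count_le_size.
by rewrite window_count_eq0 // => i /andP[Ni _] /=; rewrite ltnNge Ni.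
Qed.

(** The exceptions all lie below [N], so they cost at most [N] wherever the window
    is. *)
Lemma window_count_eventually_sub (X Y : set nat) N k n :
    (forall x, N <= x -> X x -> Y x) ->
  window_count X k n <= window_count Y k n + N.
Proof.
move=> XY; apply: (@leq_trans (window_count (Y `|` `I_N) k n)).
  apply: window_count_sub => i _ Xi; case: (ltnP i N) => [|/XY]; first by right.
  by left; auto.
exact/(leq_trans (window_countU _ _ _ _))/leq_add/window_count_initial.
Qed.

Lemma tiling_eventually_periodic A : is_tiling A ->
  exists r P N, [/\ 0 < r, periodic_set r P & forall x, N <= x -> A x <-> P x].
Proof.
move=> [r [b [T [r0 _ Tr ->]]]].
(* On [b, oo) this is the condition that the residue of [x - b] lies in [T],
   written without subtraction so as to be periodic from [0] on. *)
pose P := [set x | T ((x + r.-1 * b) %% r)].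
exists r, P, b; split=> // [x|x bx].
  by apply: eq_in_set; rewrite /P /= addnAC modnDr.
have xE : x + r.-1 * b = x - b + b * r by rewrite /posnat /= in r0; nia.
rewrite /P /= xE addnC modnMDl; split=> [[_ [j _ [t Tt <-]] xt]|].
  have tr : t < r.
    by have := Tr _ Tt; rewrite /integer_interval /posnat /= in r0 *; lia.
  by rewrite -xt addnK addnC modnMDl modn_small.
move=> Tx; exists (x - b); last by rewrite subnK.
exists ((x - b) %/ r) => //; exists ((x - b) %% r) => //.
by rewrite addnC -divn_eq.
Qed.

(** The tile is [P] restricted to one period. Taking the offset equal to the period
    makes shifting by it invisible to [P]. *)
Lemma periodic_is_tiling r P :
  0 < r -> periodic_set r P -> is_tiling [set x | r <= x /\ P x].
Proof.
move=> r0 perP; exists r, r, [set s | s < r /\ P s]; split=> //.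
  by move=> s [sr _]; rewrite /integer_interval /=; lia.
have PE x y : x = y %[mod r] -> P x -> P y.
  by move=> xy /mem_set; rewrite (periodic_eqmod perP xy) => /set_mem.
apply/seteqP; split=> [x [rx Px]|_ [_ [j _ [s [sr Ps] <-]] <-]] /=.
  exists (x - r); last by rewrite subnK.
  exists ((x - r) %/ r) => //; exists ((x - r) %% r).
    split; first by rewrite ltn_mod.
    by apply: PE Px; rewrite modn_mod -{1}(subnK rx) modnDr.
  by rewrite addnC -divn_eq.
split; first lia.
by apply: PE Ps; rewrite modnDr addnC modnMDl.
Qed.

Section Tiles.
Variable R : realType.
Local Open Scope ring_scope.

Definition period_density (r : nat) (P : set nat) : R :=
  (window_count P 0 r)%:R / r%:R.

(** Up to the [N] initial exceptions, the count up to [n] is squeezed between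
    [n %/ r] and [(n %/ r).+1] full periods. *)
Lemma eventually_periodic_density (A : set nat) r P N :
    (0 < r)%N -> periodic_set r P -> (forall x, (N <= x)%N -> A x <-> P x) ->
  has_density A (period_density r P).
Proof.
move=> r0 perP AP.
set c := window_count P 0 r; have rR : (0 : R) < r%:R by rewrite ltr0n.
apply: (@has_density_of_bounded_error _ _ _ (N%:R + c%:R)) => n.
have leAP : (window_count A 1 n <= window_count P 1 n + N)%N.
  by apply: window_count_eventually_sub => x /AP[].
have lePA : (window_count P 1 n <= window_count A 1 n + N)%N.
  by apply: window_count_eventually_sub => x /AP[].
have loP : (n %/ r * c <= window_count P 1 n)%N.
  rewrite -(window_count_periodic_mul 1 _ perP).
  exact/window_count_widen/leq_divM.
have hiP : (window_count P 1 n <= (n %/ r).+1 * c)%N.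
  rewrite -(window_count_periodic_mul 1 _ perP).
  exact/window_count_widen/ltnW/ltn_ceil.
have lo : (n %/ r * c)%:R <= period_density r P * n%:R.
  rewrite /period_density -/c mulrAC ler_pdivlMr // -!natrM ler_nat.
  by rewrite mulnAC mulnC leq_mul2l leq_divM orbT.
have hi : period_density r P * n%:R <= ((n %/ r).+1 * c)%:R.
  rewrite /period_density -/c mulrAC ler_pdivrMr // -!natrM ler_nat.
  by rewrite mulnAC [leqRHS]mulnC leq_mul2l ltnW ?orbT // ltn_ceil.
move: leAP lePA loP hiP lo hi.
rewrite -!(ler_nat R) mulSn !natrD => ? ? ? ? ? ?.
by rewrite ler_norml; apply/andP; split; lra.
Qed.

(** Tilings and eventually periodic sets are the same up to finite sets, and their
    density is the proportion of elements in a period. The infimum is over a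
    nonempty set of nonnegative numbers, so it vanishes exactly when the tilings
    that cover [X] have arbitrarily small density. *)
Lemma tile_idealP (X : set nat) :
  tile_ideal R X <-> X `<=` posnat /\
    forall e : R, 0 < e -> exists r P,
      [/\ (0 < r)%N, periodic_set r P,
          exists N, forall x, (N <= x)%N -> X x -> P x &
          period_density r P < e].
Proof.
pose S := [set l : R | exists A : set nat,
   [/\ is_tiling A, subset_mod_finite X A & has_density A l]].
have S0 l : S l -> 0 <= l by move=> [A [_ _ /has_density_ge0]].
have Speriodic r P : X `<=` posnat -> (0 < r)%N -> periodic_set r P ->
    (exists N, forall x, (N <= x)%N -> X x -> P x) -> S (period_density r P).
  move=> Xpos r0 perP [N XP]; exists [set x | (r <= x)%N /\ P x]; split.
  - exact: periodic_is_tiling.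
  - exists (X `&` `I_(N + r)).
      split; first by move=> x [/Xpos].
      exact/finite_setIr/finite_II.
    move=> x Xx; case: (ltnP x (N + r)) => xN; first by right.
    by left; split; [|apply: XP => //]; lia.
  - by apply: (@eventually_periodic_density _ _ _ r) => // x rx; split=> [[]|].
split=> -[Xpos tX]; split=> //.
  move=> e e0.
  have Sne : S !=set0.
    exists (period_density 1 setT); by apply: Speriodic => //; exists 0%N.
  have [l Sl le] : exists2 l, S l & l < e.
    apply: contrapT => noS; have : e <= inf S.
      apply: lb_le_inf => // l Sl; rewrite leNgt; apply/negP => le.
      by apply: noS; exists l.
    by rewrite [inf S]tX leNgt e0.
  have [A [tA [F [_ finF] XAF] Al]] := Sl.
  have [r [P [N [r0 perP AP]]]] := tiling_eventually_periodic tA.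
  exists r, P; split=> //.
    have [M FM] : exists M, forall x, F x -> (x < M)%N.
      exists (\max_(x <- fset_set F) x).+1 => x Fx; rewrite ltnS.
      by apply: leq_bigmax_seq => //; rewrite in_fset_set ?mem_set.
    exists (N + M)%N => x NMx /XAF[Ax|/FM]; last by lia.
    by apply/AP => //; lia.
  by rewrite -(has_density_unique Al (eventually_periodic_density r0 perP AP)).
apply/eqP; rewrite eq_le; apply/andP; split.
  apply/ler_addgt0Pr => e e0; rewrite add0r.
  have [r [P [r0 perP XP Pe]]] := tX e e0.
  apply: le_trans (ltW Pe); apply: ge_inf; first by exists 0 => l /S0.
  exact: Speriodic.
have [r [P [r0 perP XP _]]] := tX 1 ltr01.
by apply: lb_le_inf => [|l /S0 //]; exists (period_density r P); apply: Speriodic.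
Qed.

End Tiles.

(** * Reciprocal sums *)

Section Reciprocals.
Variable R : realType.
Local Open Scope ring_scope.

Definition reciprocal_sum (X : set nat) (m n : nat) : R :=
  \sum_(m <= i < n | i \in X) (i%:R)^-1.

Lemma reciprocal_sum_mkcond X m n : reciprocal_sum X m n =
  \sum_(m <= i < n) if i \in X then (i%:R)^-1 else 0.
Proof. exact: big_mkcond. Qed.

Lemma reciprocal_sum_ge0 X m n : 0 <= reciprocal_sum X m n.
Proof. by apply: sumr_ge0 => i _; rewrite invr_ge0. Qed.

Lemma reciprocal_sum_cat X k m n : (k <= m <= n)%N ->
  reciprocal_sum X k n = reciprocal_sum X k m + reciprocal_sum X m n.
Proof. by move=> /andP[km mn]; rewrite /reciprocal_sum (big_cat_nat km mn). Qed.

Lemma reciprocal_sum_widen X k m n :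
  (m <= n)%N -> reciprocal_sum X k m <= reciprocal_sum X k n.
Proof.
move=> mn; have [km|mk] := leqP k m.
  by rewrite (@reciprocal_sum_cat X k m n) ?km // lerDl reciprocal_sum_ge0.
by rewrite {1}/reciprocal_sum big_geq ?reciprocal_sum_ge0 // ltnW.
Qed.

Lemma reciprocal_sum_sub (X Y : set nat) m n :
    (forall i, (m <= i < n)%N -> X i -> Y i) ->
  reciprocal_sum X m n <= reciprocal_sum Y m n.
Proof.
move=> XY; rewrite !reciprocal_sum_mkcond !big_seq; apply: ler_sum => i.
rewrite mem_index_iota => /XY {}XY.
case: (boolP (i \in X)) => [/set_mem/XY/mem_set ->//|_].
by case: (i \in Y); rewrite // invr_ge0.
Qed.

Lemma reciprocal_sum_le_count X m n : (0 < m)%N ->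
  reciprocal_sum X m (m + n) <= (window_count X m n)%:R / m%:R.
Proof.
move=> m0; rewrite /reciprocal_sum /window_count natr_sum mulr_suml.
rewrite big_mkcond /= !big_seq; apply: ler_sum => i.
rewrite mem_index_iota => /andP[mi _]; case: (i \in X); last by rewrite mul0r.
by rewrite mul1r lef_pV2 ?posrE ?ltr0n ?ler_nat ?(leq_trans m0).
Qed.

Lemma count_le_reciprocal_sum X m n : (0 < m)%N ->
  (window_count X m n)%:R / (m + n)%:R <= reciprocal_sum X m (m + n).
Proof.
move=> m0; rewrite /reciprocal_sum /window_count natr_sum mulr_suml.
rewrite [leRHS]big_mkcond /= !big_seq; apply: ler_sum => i.
rewrite mem_index_iota => /andP[mi imn]; case: (i \in X); last by rewrite mul0r.
by rewrite mul1r lef_pV2 ?posrE ?ltr0n ?ler_nat ?(ltnW imn) //; lia.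
Qed.

Lemma reciprocal_idealP (X : set nat) :
  reciprocal_ideal R X <-> X `<=` posnat /\
    exists C, forall n, reciprocal_sum X 0 n <= C.
Proof.
pose u (n : nat) : \bar R := ((n%:R : R)^-1)%:E.
have u0 n : n \in X -> (0 <= u n)%E by rewrite lee_fin invr_ge0.
have uE n : (\sum_(0 <= i < n | i \in X) u i)%E = (reciprocal_sum X 0 n)%:E.
  by rewrite sumEFin.
rewrite /reciprocal_ideal /=.
have <- : (\sum_(0 <= i <oo | i \in X) u i)%E =
    (\esum_(x in X) ((x%:R : R)^-1)%:E)%E.
  rewrite (nneseries_esum u0); congr (esum _ _).
  by apply/seteqP; split=> x /= /[!in_setE].
split=> -[Xpos sX]; split=> //.
  exists (fine (\sum_(0 <= i <oo | i \in X) u i)%E) => n.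
  have S0 : (0 <= \sum_(0 <= i <oo | i \in X) u i)%E.
    by apply: nneseries_ge0 => i _ /u0.
  rewrite -lee_fin fineK ?ge0_fin_numE // -uE.
  by apply: nneseries_lim_ge => i _ /u0.
case: sX => C sC; apply: le_lt_trans (ltry C).
apply: lime_le; first by apply: is_cvg_nneseries => i _ /u0.
by near=> n; rewrite uE lee_fin.
Unshelve. all: by end_near. Qed.

Lemma reciprocal_sum_tail (X : set nat) (e : R) :
    reciprocal_ideal R X -> 0 < e ->
  exists N : nat, forall m n, (N <= m)%N -> reciprocal_sum X m n <= e.
Proof.
move=> /reciprocal_idealP[_ [C sC]] e0.
pose E := range (reciprocal_sum X 0).
have supE : has_sup E.
  split; first by exists (reciprocal_sum X 0 0); exists 0%N.
  by exists C => _ [n _ <-].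
have [_ [N _ <-] supN] := sup_adherent e0 supE.
exists N => m n Nm; have [mn|nm] := leqP m n; last first.
  by rewrite /reciprocal_sum big_geq ?ltW // ltnW.
have : reciprocal_sum X 0 n <= sup E by apply: ub_le_sup; [case: supE|exists n].
rewrite (@reciprocal_sum_cat X 0 m n) //.
have := reciprocal_sum_widen X 0 Nm; lra.
Qed.

(** The [j]-th block has reciprocal sum at most [2 ^- j]: its elements are at least
    [c j], and there are at most [c j / 2 ^ j] of them. The geometric series then
    bounds all partial sums. *)
Lemma reciprocal_of_blocks (X : set nat) (c : nat -> nat) : X `<=` posnat ->
    (0 < c 0)%N -> {homo c : i j / (i < j)%N} ->
    (forall j, (2 ^ j * window_count X (c j) (c j.+1 - c j) <= c j)%N) ->
  reciprocal_ideal R X.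
Proof.
move=> Xpos c0 c_incr cX; apply/reciprocal_idealP; split=> //.
have c_ge j : (j < c j)%N.
  by elim: j => // j; have := c_incr _ _ (ltnSn j); lia.
have block j : reciprocal_sum X (c j) (c j.+1) <= 2^-1 ^+ j.
  have cj0 : (0 < c j)%N by apply: leq_trans (c_ge j).
  rewrite -(subnKC (ltnW (c_incr _ _ (ltnSn j)))).
  apply: le_trans (reciprocal_sum_le_count _ _ cj0) _.
  rewrite ler_pdivrMr ?ltr0n // exprVn mulrC ler_pdivlMr ?exprn_gt0 // mulrC.
  by rewrite -natrX -natrM ler_nat.
exists (reciprocal_sum X 0 (c 0) + 2) => n.
apply: le_trans (reciprocal_sum_widen _ _ (ltnW (c_ge n))) _.
suff : reciprocal_sum X 0 (c n) <= reciprocal_sum X 0 (c 0) + 2 - 2 * 2^-1 ^+ n.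
  by move=> /le_trans; apply; rewrite gerBl mulr_ge0 // exprn_ge0 // invr_ge0.
elim: n => [|n IHn]; first by rewrite expr0; lra.
rewrite (@reciprocal_sum_cat X 0 (c n)) ?(ltnW (c_incr _ _ (ltnSn n))) //.
have := block n; move: IHn; rewrite exprS; lra.
Qed.

End Reciprocals.

(** * The ideals and their inclusions *)

Lemma all_subsets_is_ideal : is_ideal all_subsets.
Proof.
split=> // [A B Apos Bpos|A B Apos BA]; first by rewrite /all_subsets /= subUset.
exact: subset_trans Apos.
Qed.

Lemma is_idealI I J : is_ideal I -> is_ideal J -> is_ideal (I `&` J).
Proof.
move=> [Ipos IU Isub] [Jpos JU Jsub]; split=> [A [/Ipos]||] //.
  by move=> A B [IA JA] [IB JB]; split; auto.
by move=> A B [IA JA] BA; split; eauto.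
Qed.

Lemma finite_is_ideal : is_ideal finite_ideal.
Proof.
split=> [A []||] //.
  by move=> A B [Ap fA] [Bp fB]; split; rewrite ?subUset ?finite_setU.
by move=> A B [Ap fA] BA; split; [exact: subset_trans Ap|exact: sub_finite_set fA].
Qed.

Section Ideals.
Variable R : realType.
Local Open Scope ring_scope.

Lemma reciprocal_is_ideal : is_ideal (reciprocal_ideal R).
Proof.
split=> [A []||] //.
  move=> A B /reciprocal_idealP[Ap [C AC]] /reciprocal_idealP[Bp [D BD]].
  apply/reciprocal_idealP; split; first by rewrite subUset.
  exists (C + D) => n; apply: le_trans (lerD (AC n) (BD n)).
  rewrite !reciprocal_sum_mkcond -big_split /=; apply: ler_sum => i _.
  rewrite in_setU; have : 0 <= (i%:R : R)^-1 by rewrite invr_ge0.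
  by case: (i \in A); case: (i \in B) => /=; lra.
move=> A B /reciprocal_idealP[Ap [C AC]] BA.
apply/reciprocal_idealP; split; first exact: subset_trans Ap.
exists C => n; apply: le_trans (AC n).
by apply: reciprocal_sum_sub => i _ /BA.
Qed.

Lemma density_is_ideal : is_ideal (density_ideal R).
Proof.
split=> [A []||] //.
  move=> A B /density_idealP[Ap dA] /density_idealP[Bp dB].
  apply/density_idealP; split=> [|e e0]; first by rewrite subUset.
  have e20 : 0 < e / 2 by rewrite divr_gt0.
  have [M AM] := dA _ e20; have [N BN] := dB _ e20.
  exists (maxn M N) => n; rewrite geq_max => /andP[/AM An /BN Bn].
  have := window_countU A B 1 n; rewrite -(ler_nat R) natrD; lra.
move=> A B /density_idealP[Ap dA] BA.
apply/density_idealP; split=> [|e /dA[M AM]]; first exact: subset_trans Ap.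
exists M => n /AM; apply: le_trans; rewrite ler_nat.
by apply: window_count_sub => i _ /BA.
Qed.

Lemma banach_is_ideal : is_ideal (banach_ideal R).
Proof.
split=> [A []||] //.
  move=> A B /banach_idealP[Ap bA] /banach_idealP[Bp bB].
  apply/banach_idealP; split=> [|e e0]; first by rewrite subUset.
  have e20 : 0 < e / 2 by rewrite divr_gt0.
  have [M AM] := bA _ e20; have [N BN] := bB _ e20.
  exists (maxn M N) => n k; rewrite geq_max => /andP[Mn Nn].
  have := AM n k Mn; have := BN n k Nn.
  have := window_countU A B k.+1 n; rewrite -(ler_nat R) natrD; lra.
move=> A B /banach_idealP[Ap bA] BA.
apply/banach_idealP; split=> [|e /bA[M AM]]; first exact: subset_trans Ap.
exists M => n k /AM AMn; apply: le_trans (AMn k); rewrite ler_nat.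
by apply: window_count_sub => i _ /BA.
Qed.

Lemma period_density_mul r P q : (0 < q)%N ->
  periodic_set r P -> period_density R (q * r) P = period_density R r P.
Proof.
move=> q0 perP; rewrite /period_density window_count_periodic_mul //.
by rewrite !natrM -mulf_div divff ?mul1r // pnatr_eq0 -lt0n.
Qed.

(** Two periodic sets have a common period, and over it their union has at most
    the sum of their densities. *)
Lemma tile_is_ideal : is_ideal (tile_ideal R).
Proof.
split=> [A []||] //.
  move=> A B /tile_idealP[Ap tA] /tile_idealP[Bp tB].
  apply/tile_idealP; split=> [|e e0]; first by rewrite subUset.
  have e20 : 0 < e / 2 by rewrite divr_gt0.
  have [r [P [r0 perP [M AM] Pe]]] := tA _ e20.
  have [s [Q [s0 perQ [N BN] Qe]]] := tB _ e20.
  have perPs : periodic_set (r * s) P by apply: periodic_dvd (dvdn_mulr _ _).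
  have perQr : periodic_set (r * s) Q by apply: periodic_dvd (dvdn_mull _ _).
  exists (r * s)%N, (P `|` Q); split.
  - by rewrite muln_gt0 r0.
  - by move=> x; rewrite !in_setU perPs perQr.
  - exists (maxn M N) => x; rewrite geq_max => /andP[Mx Nx].
    by case=> [/(AM _ Mx)|/(BN _ Nx)]; [left|right].
  have PE : period_density R (r * s) P = period_density R r P.
    by rewrite mulnC period_density_mul.
  have QE := period_density_mul r0 perQ.
  suff : period_density R (r * s) (P `|` Q) <=
      period_density R (r * s) P + period_density R (r * s) Q.
    by rewrite PE QE; lra.
  by rewrite /period_density -mulrDl ler_wpM2r ?invr_ge0 // -natrD ler_nat
    window_countU.
move=> A B /tile_idealP[Ap tA] BA.
apply/tile_idealP; split=> [|e /tA[r [P [r0 perP [N AN] Pe]]]].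
  exact: subset_trans Ap.
by exists r, P; split=> //; exists N => x Nx /BA; exact: AN.
Qed.

Lemma finite_sub_tile : finite_ideal `<=` tile_ideal R.
Proof.
move=> X [Xp finX]; apply/tile_idealP; split=> // e e0.
exists 1%N, set0; split=> //.
  exists (\max_(x <- fset_set X) x).+1 => x maxx Xx; exfalso; move: maxx.
  by rewrite ltnNge leq_bigmax_seq // in_fset_set ?mem_set.
by rewrite /period_density /window_count big_nat1 in_set0 mul0r.
Qed.

Lemma finite_sub_reciprocal : finite_ideal `<=` reciprocal_ideal R.
Proof.
move=> X [Xp finX]; split=> //; rewrite esum_fset //.
by rewrite fsumEFin // ltry.
Qed.

(** A window of length one period meets [X] in no more points than a period of a
    periodic set that eventually contains [X]. *)
Lemma tile_sub_banach : tile_ideal R `<=` banach_ideal R.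
Proof.
move=> X /tile_idealP[Xp tX]; apply: banach_of_windows => // e e0.
have [r [P [r0 perP [N XP] Pe]]] := tX _ e0.
exists r, N; split=> // k Nk; rewrite -ler_pdivrMr ?ltr0n //.
apply: le_trans (ltW Pe); rewrite ler_wpM2r ?invr_ge0 // ler_nat.
rewrite -(window_count_periodic k perP).
by apply: window_count_sub => i /andP[ki _]; apply: XP; apply: leq_trans ki.
Qed.

Lemma banach_sub_density : banach_ideal R `<=` density_ideal R.
Proof.
move=> X /banach_idealP[Xp bX]; apply/density_idealP; split=> // e /bX[M XM].
by exists M => n /XM.
Qed.

(** Beyond a point where the tail of the reciprocal series is at most [e / 2],
    each further element of [X] up to [n] contributes at least [1 / n] to it. *)
Lemma reciprocal_sub_density : reciprocal_ideal R `<=` density_ideal R.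
Proof.
move=> X rX; have [Xp _] := rX; apply/density_idealP; split=> // e e0.
have e20 : 0 < e / 2 by rewrite divr_gt0.
have [N XN] := reciprocal_sum_tail rX e20.
have [M MC] := eventually_le_mul (N%:R + e / 2 * (1 + N)%:R) e20.
exists M => n /MC Mn.
have tail : (window_count X (1 + N) n)%:R <= e / 2 * (1 + N + n)%:R.
  rewrite -ler_pdivrMr ?ltr0n //.
  by apply: le_trans (count_le_reciprocal_sum _ _ _ _) (XN _ _ _).
have := window_count_widen X 1 (leq_addl N n).
have := window_count_le_size X 1 N.
rewrite window_countD -!(ler_nat R) natrD => headN Xn.
move: tail Mn; rewrite [(1 + N + n)%:R]natrD; lra.
Qed.

End Ideals.

(** * Much larger ideals from blocks *)

Definition block (c : nat -> nat) (j : nat) : set nat :=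
  [set x | c j <= x < c j.+1].

(** Stronger than keeping every infinite union of pieces out of [I], but this is
    what the counting arguments give, and it visibly passes to smaller [I]. *)
Definition blocks_escape (I : set (set nat)) (X : set nat) (c : nat -> nat) :=
  forall Y, I Y -> exists N, forall j, N <= j -> ~ (X `&` block c j `<=` Y).

Lemma blocks_escape_sub (I I' : set (set nat)) X c :
  I `<=` I' -> blocks_escape I' X c -> blocks_escape I X c.
Proof. by move=> II' esc Y /II'/esc. Qed.

Lemma infinite_set_unbounded (K : set nat) N :
  infinite_set K -> exists2 j, K j & N <= j.
Proof.
move=> infK; apply: contrapT => noj; apply: infK.
apply: (@sub_finite_set _ _ `I_N); last exact: finite_II.
by move=> j Kj /=; rewrite ltnNge; apply/negP => Nj; apply: noj; exists j.
Qed.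

(** The inclusion is proper because the union of all the pieces separates the two
    ideals. *)
Lemma much_larger_of_blocks I J X c :
    is_ideal I -> is_ideal J -> I `<=` J -> finite_ideal `<=` I ->
    J X -> {homo c : i j / i < j} -> (forall j, X `&` block c j !=set0) ->
    blocks_escape I X c ->
  much_larger I J.
Proof.
move=> idI idJ IJ finI JX c_incr Xne esc.
have [Jpos _ Jsub] := idJ.
pose D j := X `&` block c j.
have unionJ K : J (\bigcup_(k in K) D k).
  by apply: Jsub JX _ => x [k _ []].
have unionI K : infinite_set K -> ~ I (\bigcup_(k in K) D k).
  move=> infK /esc[N escN]; have [j Kj Nj] := infinite_set_unbounded N infK.
  by apply: (escN j Nj) => x Dx; exists j.
have inf_posnat : infinite_set posnat.
  move=> fin; apply: infinite_nat; apply: (@sub_finite_set _ _ (posnat `|` [set 0])).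
    by case=> [|n] _; [right|left].
  by rewrite finite_setU; split.
split=> //; first by split=> // JI; apply: (unionI _ inf_posnat); apply: JI.
have c_le i j x : block c i x -> block c j x -> i <= j.
  rewrite /block /= => /andP[ci _] /andP[_ cj]; rewrite leqNgt; apply/negP => ji.
  have : c j.+1 <= c i by move: ji; rewrite leq_eqVlt => /predU1P[->//|/c_incr/ltnW].
  by lia.
exists D; split.
- move=> j _; apply: finI; split; first by move=> x [/(Jpos _ JX)].
  apply: finite_setIr; apply: (@sub_finite_set _ _ `I_(c j.+1)).
    by move=> x /= /andP[].
  exact: finite_II.
- by move=> j _; apply: Xne.
- move=> i j _ _ [x [[_ xi] [_ xj]]]; apply/eqP.
  by rewrite eqn_leq (c_le _ _ _ xi xj) (c_le _ _ _ xj xi).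
- by move=> K _ infK; split; [exact: unionJ|exact: unionI].
Qed.

(** * Sets with large pieces *)

(** The runs get ever longer, yet the lengths are only the square roots of the
    positions, so that the [j]-th run has a reciprocal sum of at most [2 ^- j]. *)
Definition sparse_runs : set nat :=
  [set x | exists j, 4 ^ j <= x < 4 ^ j + 2 ^ j].

(** Gaps tend to infinity, while [m`! + m] is congruent to [m] modulo every
    [r <= m], so that enough consecutive values of [m] meet all residues. *)
Definition factorial_shifts : set nat := range (fun m => m`! + m).

(** Divisible by ever higher powers of two, but so slowly that the reciprocals of
    the multiples of [2 ^ j] taken before the next power sum to at least [1]. *)
Definition slowly_divisible : set nat :=
  [set x | 0 < x /\ forall j, 2 ^ 2 ^ j.+1 <= x -> 2 ^ j %| x].

Lemma pow4_incr : {homo expn 4 : i j / i < j}.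
Proof. by move=> i j ij; rewrite ltn_exp2l. Qed.

Lemma pow2_incr : {homo expn 2 : i j / i < j}.
Proof. by move=> i j ij; rewrite ltn_exp2l. Qed.

Lemma factorial_shift_incr : {homo (fun m => m`! + m) : i j / i < j}.
Proof.
apply: homo_ltn => [|m]; first exact: ltn_trans.
by rewrite factS; have := fact_gt0 m; nia.
Qed.

Lemma factorial_shift_pow2_incr : {homo (fun j => (2 ^ j)`! + 2 ^ j) : i j / i < j}.
Proof. by move=> i j /pow2_incr/factorial_shift_incr. Qed.

Lemma pow_pow2_incr : {homo (fun j => 2 ^ 2 ^ j.+1) : i j / i < j}.
Proof. by move=> i j ij; rewrite !ltn_exp2l. Qed.

Lemma pow2_le_pow4 j : 2 ^ j <= 4 ^ j.
Proof. by rewrite -[4]/(2 ^ 2) -expnM leq_exp2l // leq_pmull. Qed.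

Lemma sparse_runs_in_block x j : sparse_runs x -> block (expn 4) j x ->
  x < 4 ^ j + 2 ^ j.
Proof.
move=> [i /andP[ix xi]] /andP[jx xj].
have [ij|ji|<- //] := ltngtP i j.
  have : 4 ^ i.+1 <= 4 ^ j by rewrite leq_exp2l.
  have := pow2_le_pow4 i.
  by rewrite expnS; lia.
have : 4 ^ j.+1 <= 4 ^ i by rewrite leq_exp2l.
by lia.
Qed.

Lemma sparse_runs_run x j : 4 ^ j <= x < 4 ^ j + 2 ^ j ->
  (sparse_runs `&` block (expn 4) j) x.
Proof.
move=> xj; split; first by exists j.
move: xj; rewrite /block /= expnS => /andP[-> /=].
have := pow2_le_pow4 j; have := expn_gt0 4 j; lia.
Qed.

Lemma sparse_runs_pow4 j : (sparse_runs `&` block (expn 4) j) (4 ^ j).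
Proof. by apply: sparse_runs_run; have := expn_gt0 2 j; lia. Qed.

Lemma slowly_divisible_pow4 j : slowly_divisible (4 ^ j).
Proof.
split=> [|i]; first by rewrite expn_gt0.
rewrite -[4]/(2 ^ 2) -expnM leq_exp2l // => ij.
by apply/dvdn_exp2l/(leq_trans _ ij)/ltnW/(ltn_trans (ltnSn i))/ltn_expl.
Qed.

(** Within the [j]-th block the only conditions in force are divisibility by
    [2 ^ i] for [i <= j], and the last one implies the others. *)
Lemma slowly_divisible_block x j : 2 ^ j %| x ->
  block (fun j => 2 ^ 2 ^ j.+1) j x -> slowly_divisible x.
Proof.
move=> jx /andP[cx xc]; split=> [|i ix].
  by apply: leq_trans cx; rewrite expn_gt0.
apply: dvdn_trans jx; apply: dvdn_exp2l.
have : 2 ^ 2 ^ i.+1 < 2 ^ 2 ^ j.+2 by apply: leq_ltn_trans ix xc.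
by rewrite !ltn_exp2l.
Qed.

(** * Membership in the larger and escape from the smaller ideals *)

Section Witnesses.
Variable R : realType.

Lemma sparse_runs_reciprocal : reciprocal_ideal R sparse_runs.
Proof.
apply: (@reciprocal_of_blocks R _ (expn 4)) => //; last 1 first.
- move=> j.
  have fit : 2 ^ j <= 4 ^ j.+1 - 4 ^ j.
    by have := pow2_le_pow4 j; rewrite expnS; lia.
  rewrite -(subnKC fit) window_countD [X in _ * (_ + X)]window_count_eq0 => [|x].
    rewrite addn0 -[4 ^ j]/((2 * 2) ^ j) expnMn leq_mul2l.
    by rewrite window_count_le_size orbT.
  rewrite -addnA subnKC // => /andP[jx xj] run.
  have := sparse_runs_in_block (j := j) run; rewrite /block /=.
  have := leq_exp2l (m := 4) j j.+1 isT; lia.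
- by move=> x [j /andP[]]; rewrite /posnat /=; have := expn_gt0 4 j; lia.
- exact: pow4_incr.
Qed.

(** The [j]-th run is a completely filled window of length [2 ^ j]. *)
Lemma sparse_runs_escape_banach :
  blocks_escape (banach_ideal R) sparse_runs (expn 4).
Proof.
move=> Y /banach_idealP[_ /(_ (2^-1)%R)[|M YM]]; first by rewrite invr_gt0.
exists M => j Mj runY.
have MJ : M <= 2 ^ j by apply: (leq_trans Mj); rewrite ltnW // ltn_expl.
have j4 : (4 ^ j).-1.+1 = 4 ^ j by rewrite prednK // expn_gt0.
have := YM _ (4 ^ j).-1 MJ; rewrite j4 window_count_full; last first.
  by move=> x /sparse_runs_run /runY.
by rewrite leNgt gtr_pMl ?invf_lt1 ?ltr1n ?ltr0n ?expn_gt0.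
Qed.

Lemma factorial_shifts_pos : factorial_shifts `<=` posnat.
Proof. by move=> _ [m _ <-]; rewrite /posnat /= addn_gt0 fact_gt0. Qed.

Lemma factorial_shift_gap L a b :
  L <= a -> a < b -> a`! + a + L <= b`! + b.
Proof.
move=> La ab; apply: (@leq_trans (a.+1`! + a.+1)).
  by rewrite factS; have := fact_gt0 a; nia.
by move: ab; rewrite leq_eqVlt => /predU1P[<-//|/factorial_shift_incr/ltnW].
Qed.

Lemma factorial_shift_lt a b : a`! + a < b`! + b -> a < b.
Proof.
rewrite !ltnNge; apply: contra; rewrite leq_eqVlt => /predU1P[->//|].
by move=> /factorial_shift_incr/ltnW.
Qed.

Lemma factorial_shifts_reciprocal : reciprocal_ideal R factorial_shifts.
Proof.
apply: (@reciprocal_of_blocks R _ (fun m => m`! + m)) => //.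
- exact: factorial_shifts_pos.
- exact: factorial_shift_incr.
move=> m.
have le1 : window_count factorial_shifts (m`! + m)
    ((m.+1)`! + m.+1 - (m`! + m)) <= 1.
  apply: window_count_le1 => _ _ [a _ <-] [b _ <-] ma /factorial_shift_lt ab.
  have am : m <= a.
    by rewrite leqNgt; apply/negP => /factorial_shift_incr; rewrite ltnNge ma.
  have mb : m < b by apply: leq_ltn_trans ab.
  rewrite subnKC; last exact/ltnW/factorial_shift_incr.
  by move: mb; rewrite leq_eqVlt => /predU1P[<-//|/factorial_shift_incr/ltnW].
apply: (@leq_trans (2 ^ m)); first by rewrite -[leqRHS]muln1 leq_mul2l le1 orbT.
elim: m {le1} => // -[//|m] IHm; rewrite expnS [m.+2`!]factS.
by have := fact_gt0 m.+1; nia.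
Qed.

(** Far out, a window of length [L] contains at most one element, which is a
    proportion of [1 / L]. *)
Lemma factorial_shifts_banach : banach_ideal R factorial_shifts.
Proof.
apply: banach_of_windows => [|e e0]; first exact: factorial_shifts_pos.
have [M MC] := eventually_le_mul 1%R e0.
exists M.+1, ((M.+1)`! + M.+1); split=> // k Nk.
apply: le_trans (MC _ (leqnSn M)); rewrite (ler_nat R _ 1).
apply: window_count_le1 => _ _ [a _ <-] [b _ <-] ka /factorial_shift_lt ab.
have Ma : M < a.
  rewrite ltnNge; apply/negP => aM.
  by have /= := @factorial_shift_incr a M.+1 aM; lia.
have gap := factorial_shift_gap Ma ab; lia.
Qed.

(** A periodic set of density less than [1] misses a residue [s] modulo its period
    [r], whereas each late piece has an element congruent to [s]. *)
Lemma factorial_shifts_escape_tile :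
  blocks_escape (tile_ideal R) factorial_shifts (fun j => (2 ^ j)`! + 2 ^ j).
Proof.
move=> Y /tile_idealP[_ /(_ 1%R ltr01)[r [P [r0 perP [N YP] P1]]]].
have [s sr Ps] : exists2 s, s < r & s \notin P.
  apply: contrapT => fullP; move: P1; rewrite /period_density window_count_full.
    by rewrite divff ?ltxx // pnatr_eq0 -lt0n.
  move=> s /= sr; apply: contrapT => Ps; apply: fullP; exists s => //.
  by apply/negP => /set_mem.
exists (N + r) => j jN XY.
have j2 : j < 2 ^ j by apply: ltn_expl.
(* The element of [2 ^ j, 2 ^ j + r) that is congruent to [s] modulo [r]. *)
pose m := 2 ^ j + (s + r.-1 * 2 ^ j) %% r.
have m_ub : m < 2 ^ j.+1.
  rewrite expnS mul2n -addnn ltn_add2l.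
  by apply: leq_trans (ltnW j2); apply: (leq_trans (ltn_pmod _ r0)); lia.
have m_lb : 2 ^ j <= m by apply: leq_addr.
have ms : m = s %[mod r].
  by rewrite /m modnDmr addnCA -mulSn prednK // addnC mulnC modnMDl.
have ms' : m`! + m = s %[mod r].
  have /dvdnP[q ->] : r %| m`! by apply: dvdn_fact; lia.
  by rewrite modnMDl.
move/negP: Ps; apply; rewrite -(periodic_eqmod perP ms'); apply/mem_set/YP.
  by rewrite -[N]add0n; apply: leq_add; lia.
apply: XY; split; first by exists m.
rewrite /block /=; apply/andP; split; last exact: factorial_shift_incr.
by move: m_lb; rewrite leq_eqVlt => /predU1P[<-//|/factorial_shift_incr/ltnW].
Qed.

Definition multiples (q : nat) : set nat := [set x | q %| x].

Lemma periodic_multiples q : periodic_set q (multiples q).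
Proof. by move=> x; apply: eq_in_set; rewrite /multiples /= dvdn_addl. Qed.

Lemma window_count_multiples q : 0 < q -> window_count (multiples q) 0 q = 1.
Proof.
move=> q0; apply/eqP; rewrite eqn_leq; apply/andP; split.
  apply: window_count_le1 => x y /dvdnP[a ->] /dvdnP[b ->] _.
  by rewrite ltn_pmul2r // => ab; rewrite add0n leq_pmull //; lia.
rewrite /window_count add0n big_ltn // [0 \in _]mem_set //.
by rewrite /multiples /= dvdn0.
Qed.

Lemma slowly_divisible_tile : tile_ideal R slowly_divisible.
Proof.
apply/tile_idealP; split=> [x []//|e e0].
have e20 : (0 < e / 2)%R by rewrite divr_gt0.
have [j MC] := eventually_le_mul 1%R e20.
exists (2 ^ j), (multiples (2 ^ j)); split.
- by rewrite expn_gt0.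
- exact: periodic_multiples.
- by exists (2 ^ 2 ^ j.+1) => x jx [_]; apply.
rewrite /period_density window_count_multiples ?expn_gt0 //.
have jR : (0 < (2 ^ j)%:R :> R)%R by rewrite ltr0n expn_gt0.
rewrite ltr_pdivrMr //; have := MC _ (ltnW (ltn_expl j (isT : 1 < 2))).
have := mulr_gt0 e0 jR; lra.
Qed.

(** Each dyadic interval beyond [2 ^ j] holds the proportion [2 ^- j] of multiples
    of [2 ^ j], so it contributes at least [2 ^- j.+1]. *)
Lemma reciprocal_sum_multiples j n L : j <= n ->
  (L%:R <= 2 ^+ j.+1 * reciprocal_sum R (multiples (2 ^ j)) (2 ^ n) (2 ^ (n + L)))%R.
Proof.
move=> jn; elim: L => [|L IHL].
  by rewrite mulr_ge0 ?exprn_ge0 ?reciprocal_sum_ge0.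
rewrite (@reciprocal_sum_cat _ _ _ (2 ^ (n + L))); last first.
  by rewrite !leq_exp2l // leq_addr addnS leqnSn.
rewrite mulrDr -natr1 lerD // addnS expnS mul2n -addnn.
have q0 : 0 < 2 ^ (n + L) by rewrite expn_gt0.
apply: le_trans (ler_wpM2l _ (count_le_reciprocal_sum R _ _ q0)).
  2: by rewrite exprn_ge0.
have nLE : 2 ^ (n + L) = 2 ^ (n + L - j) * 2 ^ j.
  by rewrite -expnD subnK // (leq_trans jn) ?leq_addr.
rewrite {2}nLE (window_count_periodic_mul _ _ (@periodic_multiples _)).
rewrite window_count_multiples ?expn_gt0 // muln1 mulrA.
rewrite ler_pdivlMr ?ltr0n ?addn_gt0 ?q0 // mul1r -natrX -natrM ler_nat.
by rewrite addnn -mul2n expnS -mulnA leq_mul2l mulnC -nLE leqnn orbT.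
Qed.

(** The [j]-th block is made of [2 ^ j.+1] dyadic intervals, each contributing at
    least [2 ^- j.+1]; a convergent series cannot contain such pieces arbitrarily late. *)
Lemma slowly_divisible_escape_reciprocal :
  blocks_escape (reciprocal_ideal R) slowly_divisible (fun j => 2 ^ 2 ^ j.+1).
Proof.
move=> Y rY; have half0 : (0 < 2^-1 :> R)%R by rewrite invr_gt0.
have [N YN] := reciprocal_sum_tail rY half0.
exists N => j Nj XY.
have j2 : j < 2 ^ j.+1 by apply: (ltn_trans (ltnSn j)); apply: ltn_expl.
have Nc : N <= 2 ^ 2 ^ j.+1.
  by apply: (leq_trans Nj); apply: ltnW; apply: (ltn_trans j2); apply: ltn_expl.
have multY : (reciprocal_sum R (multiples (2 ^ j)) (2 ^ 2 ^ j.+1) (2 ^ 2 ^ j.+2)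
    <= reciprocal_sum R Y (2 ^ 2 ^ j.+1) (2 ^ 2 ^ j.+2))%R.
  apply: reciprocal_sum_sub => x bx jx; apply: XY; split=> //.
  exact: slowly_divisible_block bx.
have := reciprocal_sum_multiples (2 ^ j.+1) (ltnW j2).
rewrite addnn -mul2n -expnS natrX -[X in (X <= _)%R]mulr1 ler_pM2l ?exprn_gt0 //.
move=> /le_trans/(_ multY)/le_trans/(_ (YN _ _ Nc)).
by rewrite leNgt invf_lt1 ?ltr1n ?ltr0n.
Qed.

(** The upper half of the integers up to [2 ^ j.+1] is a block. *)
Lemma posnat_escape_density : blocks_escape (density_ideal R) posnat (expn 2).
Proof.
move=> Y /density_idealP[_ /(_ (4^-1)%R)[|M YM]]; first by rewrite invr_gt0.
exists M => j Mj XY.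
have M2 : M <= 2 ^ j.+1.
  apply: (leq_trans Mj).
  by rewrite (leq_trans (ltnW (ltn_expl j (isT : 1 < 2)))) ?leq_exp2l.
have q0 : 0 < 2 ^ j by rewrite expn_gt0.
have half : 2 ^ j <= window_count Y 1 (2 ^ j.+1).
  have -> : 2 ^ j.+1 = (2 ^ j).-1 + (2 ^ j + 1) by rewrite expnS; lia.
  rewrite !window_countD add1n prednK // [window_count Y (2 ^ j) _]window_count_full.
    by lia.
  move=> x jx; apply: XY; split; first by rewrite /posnat /=; lia.
  by rewrite /block /= expnS; lia.
have := YM _ M2; have q0R : (0 < (2 ^ j)%:R :> R)%R by rewrite ltr0n.
move: half; rewrite -(ler_nat R) expnS natrM; lra.
Qed.

End Witnesses.

Lemma thin_escape_finite :
  blocks_escape finite_ideal (sparse_runs `&` slowly_divisible) (expn 4).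
Proof.
move=> Y [_ finY]; exists (\max_(x <- fset_set Y) x).+1 => j maxj XY.
have runj := sparse_runs_pow4 j.
have Yj : Y (4 ^ j).
  by apply: XY; case: runj; do 2![split=> //]; exact: slowly_divisible_pow4.
have : 4 ^ j <= \max_(x <- fset_set Y) x.
  by apply: leq_bigmax_seq => //; rewrite in_fset_set ?mem_set.
by have := ltn_expl j (isT : 1 < 4); lia.
Qed.

(** * The nine relations *)

Lemma sparse_runs_blocks j : sparse_runs `&` block (expn 4) j !=set0.
Proof. by exists (4 ^ j); exact: sparse_runs_pow4. Qed.

Lemma thin_blocks j :
  (sparse_runs `&` slowly_divisible) `&` block (expn 4) j !=set0.
Proof.
exists (4 ^ j); have [runj bj] := sparse_runs_pow4 j.
by split=> //; split=> //; exact: slowly_divisible_pow4.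
Qed.

Lemma factorial_shifts_blocks j :
  factorial_shifts `&` block (fun j => (2 ^ j)`! + 2 ^ j) j !=set0.
Proof.
exists ((2 ^ j)`! + 2 ^ j); split; first by exists (2 ^ j).
by rewrite /block /= leqnn; apply: (factorial_shift_pow2_incr (ltnSn j)).
Qed.

Lemma slowly_divisible_blocks j :
  slowly_divisible `&` block (fun j => 2 ^ 2 ^ j.+1) j !=set0.
Proof.
have bj : block (fun j => 2 ^ 2 ^ j.+1) j (2 ^ 2 ^ j.+1).
  by rewrite /block /= leqnn /= !ltn_exp2l.
exists (2 ^ 2 ^ j.+1); split=> //; apply: slowly_divisible_block bj.
by apply/dvdn_exp2l/ltnW/(ltn_trans (ltnSn j))/ltn_expl.
Qed.

Lemma posnat_blocks j : posnat `&` block (expn 2) j !=set0.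
Proof.
exists (2 ^ j); split; first by rewrite /posnat /= expn_gt0.
by rewrite /block /= leqnn /= ltn_exp2l.
Qed.

Theorem corollary5p8 (R : realType) :
  let f := finite_ideal in
  let r := reciprocal_ideal R in
  let d := density_ideal R in
  let b := banach_ideal R in
  let t := tile_ideal R in
  (much_larger f (t `&` r) /\
   much_larger (t `&` r) (b `&` r) /\
   much_larger (b `&` r) r) /\
  (much_larger t b /\
   much_larger b d /\
   much_larger d all_subsets) /\
  (much_larger (t `&` r) t /\
   much_larger (b `&` r) b /\
   much_larger r d).
Proof.
move=> f r d b t.
have [[fI rI] dI] := (finite_is_ideal, reciprocal_is_ideal R, density_is_ideal R).
have [bI tI] := (banach_is_ideal R, tile_is_ideal R).
have trI : is_ideal (t `&` r) := is_idealI tI rI.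
have brI : is_ideal (b `&` r) := is_idealI bI rI.
have tb : t `<=` b := @tile_sub_banach R.
have bd : b `<=` d := @banach_sub_density R.
have rd : r `<=` d := @reciprocal_sub_density R.
have ft : f `<=` t := @finite_sub_tile R.
have fr : f `<=` r := @finite_sub_reciprocal R.
have fb : f `<=` b := subset_trans ft tb.
have fd : f `<=` d := subset_trans fb bd.
have ftr : f `<=` t `&` r by rewrite subsetI.
have fbr : f `<=` b `&` r by rewrite subsetI.
have tr_br : t `&` r `<=` b `&` r := setSI tb.
have run_r : r sparse_runs := sparse_runs_reciprocal R.
have fact_r : r factorial_shifts := factorial_shifts_reciprocal R.
have fact_b : b factorial_shifts := factorial_shifts_banach R.
have div_t : t slowly_divisible := slowly_divisible_tile R.
have run_esc : blocks_escape b sparse_runs _ := sparse_runs_escape_banach (R := R).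
have fact_esc : blocks_escape t factorial_shifts _ :=
  factorial_shifts_escape_tile (R := R).
have div_esc : blocks_escape r slowly_divisible _ :=
  slowly_divisible_escape_reciprocal (R := R).
have pos_esc : blocks_escape d posnat _ := posnat_escape_density (R := R).
have [tr_t tr_r] : t `&` r `<=` t /\ t `&` r `<=` r by split=> X [].
have [br_b br_r] : b `&` r `<=` b /\ b `&` r `<=` r by split=> X [].
have thin_tr : (t `&` r) (sparse_runs `&` slowly_divisible).
  have [[_ _ tsub] [_ _ rsub]] := (tI, rI).
  by split; [apply: tsub div_t _ => x []|apply: rsub run_r _ => x []].
split; [|split]; (split; [|split]).
- exact: (much_larger_of_blocks fI trI ftr (@subset_refl _ _) thin_tr pow4_incr
    thin_blocks thin_escape_finite).
- apply: (much_larger_of_blocks trI brI tr_br ftr _ factorial_shift_pow2_incr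
    factorial_shifts_blocks (blocks_escape_sub tr_t fact_esc)).
  by split.
- exact: (much_larger_of_blocks brI rI br_r fbr run_r pow4_incr
    sparse_runs_blocks (blocks_escape_sub br_b run_esc)).
- exact: (much_larger_of_blocks tI bI tb ft fact_b factorial_shift_pow2_incr
    factorial_shifts_blocks fact_esc).
- exact: (much_larger_of_blocks bI dI bd fb (rd _ run_r) pow4_incr
    sparse_runs_blocks run_esc).
- apply: (much_larger_of_blocks dI all_subsets_is_ideal _ fd _ pow2_incr
    posnat_blocks pos_esc) => //.
  by have [] := dI.
- exact: (much_larger_of_blocks trI tI tr_t ftr div_t pow_pow2_incr
    slowly_divisible_blocks (blocks_escape_sub tr_r div_esc)).
- exact: (much_larger_of_blocks brI bI br_b fbr (tb _ div_t) pow_pow2_incr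
    slowly_divisible_blocks (blocks_escape_sub br_r div_esc)).
- exact: (much_larger_of_blocks rI dI rd fr (bd _ (tb _ div_t)) pow_pow2_incr
    slowly_divisible_blocks div_esc).
Qed.
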